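(* Let $\mathsf{JL}$ be a propositional justification logic (as described in the context) whose axioms include the scheme $\mathrm{jT}$: $t:A\rightarrow A$. Then $\mathsf{JL}(\mathsf{FP})_{\mathcal{TCS}}$, the fixed point extension of $\mathsf{JL}$ with the total constant specification, is inconsistent (it proves $\bot$).
   Context: Justification terms are built from justification variables $x,y,\dots$ and justification constants $c,\dots$ using binary application $\cdot$, binary sum $+$, and, depending on the logic, unary operations $!$, $?$, $\bar{?}$. Formulas: $A::= p\mid\bot\mid\neg A\mid A\wedge A\mid A\vee A\mid A\rightarrow A\mid t:A$, with $p$ a propositional variable and $t$ a term. The basic logic $\mathsf{J}$ has axioms: all propositional tautologies; Sum: $s:A\rightarrow(s+t):A$, $s:A\rightarrow(t+s):A$; jK: $s:(A\rightarrow B)\rightarrow(t:A\rightarrow(s\cdot t):B)$. A justification logic $\mathsf{JL}$ is obtained by adding to $\mathsf{J}$ some of: jT: $t:A\rightarrow A$; jD: $t:\bot\rightarrow\bot$; j4: $t:A\rightarrow !t:t:A$; jB: $\neg A\rightarrow\bar{?}t:\neg t:A$; j5: $\neg t:A\rightarrow ?t:\neg t:A$ (the language contains exactly the term operations occurring in its axioms). Rules: Modus Ponens and Iterated Axiom Necessitation (IAN): $\vdash c_{i_n}:c_{i_{n-1}}:\dots:c_{i_1}:A$ for any axiom instance $A$, any constants $c_{i_j}$, $n\ge1$. The total constant specification $\mathcal{TCS}$ is the set of all formulas produced by IAN; for a subset $\mathcal{CS}$ of it, $\mathsf{JL}_{\mathcal{CS}}$ is the logic in which IAN only produces members of $\mathcal{CS}$.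 Fixed point extension: an occurrence of $p$ in a formula $A(p,q_1,\dots,q_n)$ is justified if it lies in the scope of some justification operator $t:$. The language $\mathcal{L}(\mathsf{FP})$ extends the language by an $n$-ary operator $\delta_A$ for each formula $A(p,q_1,\dots,q_n)$ in which every occurrence of $p$ is justified, and $\mathsf{JL}(\mathsf{FP})$ adds to $\mathsf{JL}$ (with all schemes now ranging over $\mathcal{L}(\mathsf{FP})$) the fixed point axioms $\delta_A(B_1,\dots,B_n)\leftrightarrow A(\delta_A(B_1,\dots,B_n),B_1,\dots,B_n)$ for all $\mathcal{L}(\mathsf{FP})$-formulas $B_i$. Constant specifications and $\mathsf{JL}(\mathsf{FP})_{\mathcal{CS}}$ are defined as for $\mathsf{JL}$, with axiom instances of $\mathsf{JL}(\mathsf{FP})$ (so $\mathcal{TCS}$ consists of all $c_{i_n}:\dots:c_{i_1}:A$ with $A$ an axiom instance of $\mathsf{JL}(\mathsf{FP})$). *)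

(* Defs.v *)
From HB Require Import structures.
From mathcomp Require Import all_boot.

Set Implicit Arguments.
Unset Strict Implicit.
Unset Printing Implicit Defensive.

(* A justification logic JL is J plus a choice of some of the five optional
   axiom schemes. *)
Record logic := Logic {
  hasT : bool;
  hasD : bool;
  has4 : bool;
  hasB : bool;
  has5 : bool
}.

(* The operations !, \bar{?} and ? belong to the language exactly when the
   axiom mentioning them is present, whence the boolean premises. *)
Inductive term (L : logic) : Type :=
| TVar of nat
| TConst of nat
| TApp of term L & term L
| TSum of term L & term L
| TBang of has4 L & term L
| TBarQ of hasB L & term L
| TQ of has5 L & term L.

(* TVar and TConst are the justification variables and constants, both
   numbered by nat. *)
Arguments TVar {L} _.
Arguments TConst {L} _.

Record signature := Signature { op : Type; arity : op -> nat }.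

(* Formulas over the propositional variables p_0, p_1, ..., with additional
   sentential operators taken from S. *)
Inductive formula (L : logic) (S : signature) : Type :=
| Var of nat
| Bot
| Neg of formula L S
| And of formula L S & formula L S
| Or of formula L S & formula L S
| Imp of formula L S & formula L S
| Just of term L & formula L S
| Op (o : op S) of {ffun 'I_(arity o) -> formula L S}.

Arguments Var {L S} _.
Arguments Bot {L S}.

Definition Iff L S (A B : formula L S) : formula L S :=
  And (Imp A B) (Imp B A).

(* Variables, formulas t:A and formulas built by an operator of S are
   propositionally atomic; v is only ever consulted on those. *)
Fixpoint eval L S (v : formula L S -> bool) (A : formula L S) : bool :=
  match A with
  | Bot => false
  | Neg B => ~~ eval v B
  | And B C => eval v B && eval v C
  | Or B C => eval v B || eval v C
  | Imp B C => eval v B ==> eval v C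
  | Var _ | Just _ _ | Op _ _ => v A
  end.

Definition tautology L S (A : formula L S) : Prop :=
  forall v : formula L S -> bool, eval v A.

Inductive JL_axiom L S : formula L S -> Prop :=
| Ax_taut A : tautology A -> JL_axiom A
| Ax_suml s t A : JL_axiom (Imp (Just s A) (Just (TSum s t) A))
| Ax_sumr s t A : JL_axiom (Imp (Just s A) (Just (TSum t s) A))
| Ax_jK s t A B :
    JL_axiom (Imp (Just s (Imp A B)) (Imp (Just t A) (Just (TApp s t) B)))
| Ax_jT of hasT L : forall t A, JL_axiom (Imp (Just t A) A)
| Ax_jD of hasD L : forall t, JL_axiom (Imp (Just t Bot) Bot)
| Ax_j4 (h : has4 L) t A :
    JL_axiom (Imp (Just t A) (Just (TBang h t) (Just t A)))
| Ax_jB (h : hasB L) t A :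
    JL_axiom (Imp (Neg A) (Just (TBarQ h t) (Neg (Just t A))))
| Ax_j5 (h : has5 L) t A :
    JL_axiom (Imp (Neg (Just t A)) (Just (TQ h t) (Neg (Just t A)))).

(* Everything obtainable by iterated axiom necessitation from Ax:
   c_n : ... : c_1 : A with n >= 1, A in Ax and arbitrary constants. *)
Inductive TCS L S (Ax : formula L S -> Prop) : formula L S -> Prop :=
| TCS_axiom c A : Ax A -> TCS Ax (Just (TConst c) A)
| TCS_iter c A : TCS Ax A -> TCS Ax (Just (TConst c) A).

Inductive provable L S (Ax CS : formula L S -> Prop) : formula L S -> Prop :=
| Pr_axiom A : Ax A -> provable Ax CS A
| Pr_MP A B : provable Ax CS (Imp A B) -> provable Ax CS A -> provable Ax CS B
| Pr_IAN A : TCS Ax A -> CS A -> provable Ax CS A.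

(* The language of JL itself has no additional operators. *)
Definition base_sig : signature := @Signature void (of_void nat).

Fixpoint vars L (A : formula L base_sig) : seq nat :=
  match A with
  | Var p => [:: p]
  | Bot => [::]
  | Neg B | Just _ B => vars B
  | And B C | Or B C | Imp B C => vars B ++ vars C
  | Op o _ => match o with end
  end.

(* Every occurrence of p in A lies in the scope of some "t:". *)
Fixpoint justified L (p : nat) (A : formula L base_sig) : bool :=
  match A with
  | Var q => q != p
  | Bot => true
  | Neg B => justified p B
  | And B C | Or B C | Imp B C => justified p B && justified p C
  | Just _ _ => true
  | Op o _ => match o with end
  end.

Fixpoint subst L S (sigma : nat -> formula L S) (A : formula L base_sig)
    : formula L S :=
  match A with
  | Var p => sigma p
  | Bot => Bot
  | Neg B => Neg (subst sigma B)
  | And B C => And (subst sigma B) (subst sigma C)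
  | Or B C => Or (subst sigma B) (subst sigma C)
  | Imp B C => Imp (subst sigma B) (subst sigma C)
  | Just t B => Just t (subst sigma B)
  | Op o _ => match o with end
  end.

(* The index of delta_A: a formula A of JL presented as A(p, q_1, ..., q_n),
   i.e. with p, q_1, ..., q_n distinct and including all variables of A. *)
Record fp_op (L : logic) := FpOp {
  fp_body : formula L base_sig;
  fp_var : nat;
  fp_params : seq nat;
  fp_uniq : uniq (fp_var :: fp_params);
  fp_vars : {subset vars fp_body <= fp_var :: fp_params};
  fp_justified : justified fp_var fp_body
}.

Definition fp_sig (L : logic) : signature :=
  @Signature (fp_op L) (fun d => size (fp_params d)).

(* A(C, B_1, ..., B_n), by simultaneous substitution of C for p and B_i for
   q_i; the default Var r is never reached, by fp_vars. *)
Definition fp_subst L S (d : fp_op L) (C : formula L S)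
    (B : {ffun 'I_(size (fp_params d)) -> formula L S}) : formula L S :=
  subst (fun r => if r == fp_var d then C
                  else oapp B (Var r) (insub (index r (fp_params d))))
        (fp_body d).

Inductive JLFP_axiom (L : logic) : formula L (fp_sig L) -> Prop :=
| Ax_JL A : JL_axiom A -> JLFP_axiom A
| Ax_FP (d : fp_op L)
    (B : {ffun 'I_(size (fp_params d)) -> formula L (fp_sig L)}) :
    JLFP_axiom (Iff (@Op L (fp_sig L) d B)
                    (fp_subst (@Op L (fp_sig L) d B) B)).

Definition JLFP_provable (L : logic) (CS : formula L (fp_sig L) -> Prop)
    : formula L (fp_sig L) -> Prop :=
  provable (@JLFP_axiom L) CS.

Definition JLFP_TCS (L : logic) : formula L (fp_sig L) -> Prop :=
  TCS (@JLFP_axiom L).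

Definition JLFP_inconsistent (L : logic) (CS : formula L (fp_sig L) -> Prop)
    : Prop :=
  JLFP_provable CS Bot.

(* Main.v *)
(* For the liar-style fixed point d <-> ~ t:d, the formula d follows tautologically
   from this equivalence and t:d -> d. Each premise is an axiom, hence justified by a constant c
   whatever t is, so t may be chosen in advance as the term (c . c) . c of that very
   derivation; then both d and t:d are provable, contradicting d -> ~ t:d. *)
Require Import Defs.
From mathcomp Require Import all_boot.

Set Implicit Arguments.
Unset Strict Implicit.
Unset Printing Implicit Defensive.

Definition liar_term (L : logic) : term L :=
  TApp (TApp (TConst 0) (TConst 0)) (TConst 0).

Definition liar_body (L : logic) : formula L base_sig :=
  Neg (Just (liar_term L) (Var 0)).

Definition liar_op (L : logic) : fp_op L :=
  @FpOp L (liar_body L) 0 [::] isT (fun x => id) isT.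

(** [liar_op] has no parameters, so the argument family is indexed by ['I_0] and its value [Bot] is
    never read. *)
Definition liar (L : logic) : formula L (fp_sig L) :=
  @Op L (fp_sig L) (liar_op L) [ffun=> Bot].

Lemma provable_TApp L S (Ax : formula L S -> Prop) (s t : term L) A B :
  (forall C, JL_axiom C -> Ax C) ->
  provable Ax (TCS Ax) (Just s (Imp A B)) -> provable Ax (TCS Ax) (Just t A) ->
  provable Ax (TCS Ax) (Just (TApp s t) B).
Proof.
by move=> JLAx sAB tA; apply: Pr_MP tA; apply: Pr_MP sAB; apply/Pr_axiom/JLAx/Ax_jK.
Qed.

Lemma provable_TConst L S (Ax : formula L S -> Prop) c A :
  Ax A -> provable Ax (TCS Ax) (Just (TConst c) A).
Proof. by move=> AxA; apply: Pr_IAN; apply: TCS_axiom. Qed.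

Theorem theorem18 (L : logic) (hT : hasT L) :
  JLFP_inconsistent (@JLFP_TCS L).
Proof.
pose d := liar L; pose td := Just (liar_term L) d.
(* [fp_subst] computes on [liar_body]: [Var 0] becomes [d], so the fixed point axiom is this
   equivalence by conversion. *)
have fixd : JLFP_axiom (Iff d (Neg td)) by apply: (@Ax_FP L (liar_op L)).
have factd : JLFP_axiom (Imp td d) by apply/Ax_JL/Ax_jT.
have tautd : JLFP_axiom (Imp (Iff d (Neg td)) (Imp (Imp td d) d)).
  by apply/Ax_JL/Ax_taut => v /=; case: (v _); case: (v _).
have tautbot : JLFP_axiom (Imp (Iff d (Neg td)) (Imp d (Imp td Bot))).
  by apply/Ax_JL/Ax_taut => v /=; case: (v _); case: (v _).
have pr_td : JLFP_provable (@JLFP_TCS L) td.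
  (* The applications retrace [liar_term]: its constants justify, from left to right, [tautd],
     [fixd] and [factd]. *)
  apply: (provable_TApp (@Ax_JL L)) (provable_TConst 0 factd).
  apply: (provable_TApp (@Ax_JL L)) (provable_TConst 0 fixd).
  exact: provable_TConst.
have pr_d : JLFP_provable (@JLFP_TCS L) d := Pr_MP (Pr_axiom _ factd) pr_td.
by apply: Pr_MP pr_td; apply: Pr_MP pr_d; apply: Pr_MP (Pr_axiom _ fixd); apply: Pr_axiom.
Qed.
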